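(* In the free Lie ring (Lie algebra over $\mathbb Z$) on $x,y,a,b,c$ put \[ r_1=x+[x,[x,y]],\qquad r_2=y-[y,[x,y]], \] \[ s_1=a+[[x,y],a]+[y,c]-[x,y],\qquad s_2=b-[[x,y],b]-[x,c],\qquad s_3=c+[x,a]-[y,b], \] and consider the Lie ring presentations \[ \mathcal L_1=\langle x,y\mid r_1,r_2\rangle\ \subset\ \mathcal L_2=\langle x,y,a,b,c\mid r_1,r_2,s_1,s_2,s_3\rangle . \] Then \[ \Pi_2(\mathcal L_1)\neq 0,\qquad \Pi_2(\mathcal L_2)=0 . \] Moreover, for every field $k$, after base change to $k$ (that is, regarding the same generators and relators as presentations of Lie algebras over $k$) the presentation $\mathcal L_1$ is non-aspherical and the presentation $\mathcal L_2$ is aspherical. Consequently $\mathcal L_1\subset\mathcal L_2$ is a counterexample, over every field, to the statement that every subpresentation of an aspherical Lie algebra presentation is aspherical. In particular, the element $\omega=y\,e_{r_1}+x\,e_{r_2}$ is a nonzero element of $\Pi_2(\mathcal L_1)$, and its image in $\Pi_2(\mathcal L_2)$ under the map induced by the inclusion $\mathcal L_1\subset\mathcal L_2$ is zero.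
   Context: Let $k$ be $\mathbb Z$ or a field, $F=\operatorname{Lie}_k(X)$ the free Lie algebra over $k$ on a finite set $X$, $R$ the ideal of $F$ generated by relations $\rho_1,\dots,\rho_m\in F$, and $G=F/R$ the Lie algebra presented by $\mathcal P=\langle X\mid\rho_1,\dots,\rho_m\rangle$. The abelianized relation ideal $R^{\mathrm{ab}}=R/[R,R]$ is a left module over the universal enveloping algebra $U(G)$ (over $k$), with the action induced by the adjoint action of $F$ on $R$. Define the $U(G)$-module homomorphism \[ \partial_{\mathcal P}:\bigoplus_{i=1}^m U(G)e_{\rho_i}\longrightarrow R^{\mathrm{ab}},\qquad e_{\rho_i}\longmapsto \rho_i+[R,R], \] where the source is the free left $U(G)$-module on the symbols $e_{\rho_i}$. For $k=\mathbb Z$, $\Pi_2(\mathcal P)=\ker\partial_{\mathcal P}$ is the integral module of identities among relations. For $k$ a field, the corresponding kernel is the second homotopy module $\pi_2(\mathcal P)$ of the Lie algebra presentation, and $\mathcal P$ is called aspherical if this module vanishes (non-aspherical otherwise). A subpresentation of a presentation is one whose generators form a subset of the generators and whose relators form a subset of the relators (lying in the free Lie algebra on the smaller generating set). For the inclusion $\mathcal L_1\subset\mathcal L_2$, with presented Lie rings $G_1,G_2$, the induced map $\Pi_2(\mathcal L_1)\to\Pi_2(\mathcal L_2)$ is the restriction of the map of free modules sending $u\,e_{r_i}$ to $\bar u\,e_{r_i}$, where $u\mapsto\bar u$ is the ring homomorphism $U(G_1)\to U(G_2)$ induced by the natural map $G_1\to G_2$. In $\omega$, the letters $x,y$ in the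 coefficients denote the images of the generators in $U(G_1)$. *)

(* Defs.v *)
From HB Require Import structures.
From mathcomp Require Import all_boot all_order all_algebra.
From mathcomp Require Import generic_quotient ring_quotient.
From mathcomp Require Import boolp classical_sets.

Set Implicit Arguments.
Unset Strict Implicit.
Unset Printing Implicit Defensive.

Import GRing.Theory.

Local Open Scope ring_scope.
Local Open Scope quotient_scope.
Local Open Scope classical_set_scope.

HB.mixin Record Lmodule_isLieAlgebra (k : comNzRingType) (L : Type)
    of GRing.Lmodule k L := {
  lie : L -> L -> L;
  lieDl : forall a x y z, lie (a *: x + y) z = a *: lie x z + lie y z;
  lieDr : forall a x y z, lie z (a *: x + y) = a *: lie z x + lie z y;
  liexx : forall x, lie x x = 0;
  lie_jacobi : forall x y z,
    lie x (lie y z) + lie y (lie z x) + lie z (lie x y) = 0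
}.

#[short(type="liealgType")]
HB.structure Definition LieAlgebra (k : comNzRingType) :=
  {L of GRing.Lmodule k L & Lmodule_isLieAlgebra k L}.

Notation "⁅ x , y ⁆" := (lie x y)
  (at level 0, x at level 99, y at level 99, format "⁅ x ,  y ⁆") : ring_scope.

HB.mixin Record isLieMorphism (k : comNzRingType) (L M : liealgType k)
    (f : L -> M) := {
  lie_morph : {morph f : x y / ⁅x, y⁆}
}.

#[short(type="lieHom")]
HB.structure Definition LieMorphism (k : comNzRingType) (L M : liealgType k) :=
  {f of @GRing.Linear k L M *:%R f & @isLieMorphism k L M f}.

Section LieTheory.
Variables (k : comNzRingType) (L : liealgType k).
Implicit Types x y z : L.

Lemma lie0x x : ⁅0, x⁆ = 0.
Proof. by have := lieDl (-1) 0 0 x; rewrite !scaleN1r oppr0 addr0 addNr. Qed.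

Lemma liex0 x : ⁅x, 0⁆ = 0.
Proof. by have := lieDr (-1) 0 0 x; rewrite !scaleN1r oppr0 addr0 addNr. Qed.

Lemma lieZx a x z : ⁅a *: x, z⁆ = a *: ⁅x, z⁆.
Proof. by rewrite -[a *: x]addr0 lieDl lie0x addr0. Qed.

Lemma liexZ a x z : ⁅z, a *: x⁆ = a *: ⁅z, x⁆.
Proof. by rewrite -[a *: x]addr0 lieDr liex0 addr0. Qed.

Lemma lieDx x y z : ⁅x + y, z⁆ = ⁅x, z⁆ + ⁅y, z⁆.
Proof. by rewrite -[x]scale1r lieDl !scale1r. Qed.

Lemma liexD x y z : ⁅z, x + y⁆ = ⁅z, x⁆ + ⁅z, y⁆.
Proof. by rewrite -[x]scale1r lieDr !scale1r. Qed.

Lemma lieNx x z : ⁅- x, z⁆ = - ⁅x, z⁆.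
Proof. by rewrite -!scaleN1r lieZx. Qed.

Lemma liexN x z : ⁅z, - x⁆ = - ⁅z, x⁆.
Proof. by rewrite -!scaleN1r liexZ. Qed.

Lemma lieC x y : ⁅x, y⁆ = - ⁅y, x⁆.
Proof.
apply/eqP; rewrite -addr_eq0; apply/eqP.
by have := liexx (x + y); rewrite lieDx !liexD !liexx addr0 add0r.
Qed.

Lemma lie_ad x y z : ⁅⁅x, y⁆, z⁆ = ⁅x, ⁅y, z⁆⁆ - ⁅y, ⁅x, z⁆⁆.
Proof.
have := lie_jacobi x y z; rewrite [⁅z, ⁅x, y⁆⁆]lieC [⁅z, x⁆]lieC liexN.
by move/eqP; rewrite subr_eq0 => /eqP <-.
Qed.
End LieTheory.

Record lieIdeal (k : comNzRingType) (L : liealgType k) : Type := LieIdeal {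
  ideal_pred :> {pred L};
  ideal_pred_closed : submod_closed ideal_pred;
  ideal_pred_stable : forall x y, y \in ideal_pred -> ⁅x, y⁆ \in ideal_pred
}.
Arguments ideal_pred : simpl never.

HB.instance Definition _ (k : comNzRingType) (L : liealgType k) (I : lieIdeal L) :=
  GRing.isSubmodClosed.Build k L (ideal_pred I) (ideal_pred_closed I).

Section Generated.
Variables (k : comNzRingType).

Definition is_submodule (V : lmodType k) (S : set V) : Prop :=
  S 0 /\ forall a x y, S x -> S y -> S (a *: x + y).

Definition is_lie_ideal (L : liealgType k) (I : set L) : Prop :=
  is_submodule I /\ forall x y, I y -> I ⁅x, y⁆.

Definition ideal_gen_pred (L : liealgType k) (A : set L) : L -> bool :=
  fun x => `[< smallest (@is_lie_ideal L) A x >].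

Fact ideal_gen_closed (L : liealgType k) (A : set L) :
  submod_closed (ideal_gen_pred A : {pred L}).
Proof.
split; first by apply/asboolP => I /= [II _]; exact: II.1.1.
move=> a x y /asboolP Ix /asboolP Iy; apply/asboolP => I /= II.
by apply: II.1.1.2; [apply: Ix|apply: Iy].
Qed.

Fact ideal_gen_stable (L : liealgType k) (A : set L) (x y : L) :
  y \in (ideal_gen_pred A : {pred L}) -> ⁅x, y⁆ \in (ideal_gen_pred A : {pred L}).
Proof.
move=> /asboolP Iy; apply/asboolP => I /= II.
by apply: II.1.2; apply: Iy.
Qed.

Definition ideal_gen (L : liealgType k) (A : set L) : lieIdeal L :=
  LieIdeal (@ideal_gen_closed L A) (@ideal_gen_stable L A).

Lemma mem_ideal_gen (L : liealgType k) (A : set L) x : A x -> x \in ideal_gen A.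
Proof. by move=> Ax; apply/asboolP => I /= [_]; apply. Qed.

(* [L, L], the submodule spanned by the brackets *)
Definition derived_pred (L : liealgType k) : L -> bool :=
  fun x => `[< smallest (@is_submodule L) [set ⁅u, v⁆ | u in setT & v in setT] x >].

Fact derived_closed (L : liealgType k) : submod_closed (@derived_pred L : {pred L}).
Proof.
split; first by apply/asboolP => I /= [II _]; exact: II.1.
move=> a x y /asboolP Ix /asboolP Iy; apply/asboolP => I /= II.
by apply: II.1.2; [apply: Ix|apply: Iy].
Qed.

Fact lie_derived (L : liealgType k) (x y : L) : ⁅x, y⁆ \in (@derived_pred L : {pred L}).
Proof. by apply/asboolP => I /= [_]; apply; exists x => //; exists y. Qed.

Definition derived (L : liealgType k) : lieIdeal L :=
  LieIdeal (@derived_closed L) (fun x y _ => lie_derived x y).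
End Generated.
Arguments derived {k} L.

Section LieQuotient.
Variables (k : comNzRingType) (L : liealgType k) (I : lieIdeal L).

Local Notation quotI :=
  (Quotient.quot (GRing.ZmodClosed.clone L (ideal_pred I) _)).

Definition lie_quot : Type := quotI.
HB.instance Definition _ := GRing.Zmodule.on lie_quot.

Definition lie_proj (x : L) : lie_quot := \pi_(quotI) x.

Lemma lie_projP (P : lie_quot -> Prop) :
  (forall x, P (lie_proj x)) -> forall u, P u.
Proof. by move=> H u; have := H (repr (u : quotI)); rewrite /lie_proj reprK. Qed.

Definition lie_repr (u : lie_quot) : L := repr (u : quotI).

Lemma lie_reprK u : lie_proj (lie_repr u) = u.
Proof. exact: reprK. Qed.

Lemma lie_proj_eq x y : (lie_proj x = lie_proj y) <-> (x - y \in I).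
Proof. by rewrite Quotient.idealrBE; split=> [e|/eqP//]; apply/eqP. Qed.

Lemma lie_repr_proj x : lie_repr (lie_proj x) - x \in I.
Proof. by apply/lie_proj_eq; rewrite lie_reprK. Qed.

Lemma lie_projD x y : lie_proj (x + y) = lie_proj x + lie_proj y.
Proof. by rewrite /lie_proj raddfD. Qed.

Definition lie_quot_scale (a : k) (u : lie_quot) := lie_proj (a *: lie_repr u).
Definition lie_quot_lie (u v : lie_quot) := lie_proj ⁅lie_repr u, lie_repr v⁆.

Lemma lie_quot_scaleE a x : lie_quot_scale a (lie_proj x) = lie_proj (a *: x).
Proof. by apply/lie_proj_eq; rewrite -scalerBr rpredZ// lie_repr_proj. Qed.

Lemma lie_stabler x y : x \in I -> ⁅x, y⁆ \in I.
Proof. by move=> Ix; rewrite lieC rpredN ideal_pred_stable. Qed.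

Lemma lie_quot_lieE x y :
  lie_quot_lie (lie_proj x) (lie_proj y) = lie_proj ⁅x, y⁆.
Proof.
apply/lie_proj_eq; set x' := lie_repr _; set y' := lie_repr _.
have -> : ⁅x', y'⁆ - ⁅x, y⁆ = ⁅x' - x, y'⁆ + ⁅x, y' - y⁆.
  by rewrite lieDx liexD lieNx liexN addrA subrK.
by apply: rpredD; [apply: lie_stabler|apply: ideal_pred_stable]; apply: lie_repr_proj.
Qed.

Fact lie_quot_scalerA a b v :
  lie_quot_scale a (lie_quot_scale b v) = lie_quot_scale (a * b) v.
Proof. by elim/lie_projP: v => x; rewrite !lie_quot_scaleE scalerA. Qed.
Fact lie_quot_scale1r : left_id 1 lie_quot_scale.
Proof. by elim/lie_projP => x; rewrite !lie_quot_scaleE scale1r. Qed.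
Fact lie_quot_scalerDr : right_distributive lie_quot_scale +%R.
Proof.
move=> a; elim/lie_projP => x; elim/lie_projP => y.
by rewrite -lie_projD !lie_quot_scaleE scalerDr lie_projD.
Qed.
Fact lie_quot_scalerDl v : {morph lie_quot_scale^~ v : a b / a + b}.
Proof.
by move=> a b; elim/lie_projP: v => x; rewrite !lie_quot_scaleE scalerDl lie_projD.
Qed.
HB.instance Definition _ := GRing.Zmodule_isLmodule.Build k lie_quot
  lie_quot_scalerA lie_quot_scale1r lie_quot_scalerDr lie_quot_scalerDl.

Fact lie_proj_is_linear : linear lie_proj.
Proof. by move=> a x y; rewrite lie_projD -lie_quot_scaleE. Qed.
HB.instance Definition _ :=
  GRing.isLinear.Build k L lie_quot *:%R lie_proj lie_proj_is_linear.

Fact lie_quot_lieDl a x y z :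
  lie_quot_lie (a *: x + y) z = a *: lie_quot_lie x z + lie_quot_lie y z.
Proof.
elim/lie_projP: x => x; elim/lie_projP: y => y; elim/lie_projP: z => z.
by rewrite -linearP !lie_quot_lieE lieDl linearP.
Qed.
Fact lie_quot_lieDr a x y z :
  lie_quot_lie z (a *: x + y) = a *: lie_quot_lie z x + lie_quot_lie z y.
Proof.
elim/lie_projP: x => x; elim/lie_projP: y => y; elim/lie_projP: z => z.
by rewrite -linearP !lie_quot_lieE lieDr linearP.
Qed.
Fact lie_quot_liexx x : lie_quot_lie x x = 0.
Proof. by elim/lie_projP: x => x; rewrite lie_quot_lieE liexx linear0. Qed.
Fact lie_quot_jacobi x y z :
  lie_quot_lie x (lie_quot_lie y z) + lie_quot_lie y (lie_quot_lie z x)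
    + lie_quot_lie z (lie_quot_lie x y) = 0.
Proof.
elim/lie_projP: x => x; elim/lie_projP: y => y; elim/lie_projP: z => z.
by rewrite !lie_quot_lieE -!linearD lie_jacobi linear0.
Qed.
HB.instance Definition _ := Lmodule_isLieAlgebra.Build k lie_quot
  lie_quot_lieDl lie_quot_lieDr lie_quot_liexx lie_quot_jacobi.

Fact lie_proj_lie : {morph lie_proj : x y / ⁅x, y⁆}.
Proof. by move=> x y; rewrite -lie_quot_lieE. Qed.
HB.instance Definition _ := isLieMorphism.Build k L lie_quot lie_proj lie_proj_lie.

Record ideal_sub : Type := IdealSub {
  ideal_val : L; ideal_valP : ideal_val \in I }.
HB.instance Definition _ := [isSub of ideal_sub for ideal_val].
HB.instance Definition _ := [Choice of ideal_sub by <:].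
HB.instance Definition _ := [SubChoice_isSubLmodule of ideal_sub by <:].

Definition ideal_act (x : L) (r : ideal_sub) : ideal_sub :=
  IdealSub (ideal_pred_stable x (ideal_valP r)).

Definition ideal_lie (r s : ideal_sub) : ideal_sub := ideal_act (val r) s.

Fact ideal_lieDl a x y z :
  ideal_lie (a *: x + y) z = a *: ideal_lie x z + ideal_lie y z.
Proof. by apply: val_inj; exact: lieDl. Qed.
Fact ideal_lieDr a x y z :
  ideal_lie z (a *: x + y) = a *: ideal_lie z x + ideal_lie z y.
Proof. by apply: val_inj; exact: lieDr. Qed.
Fact ideal_liexx x : ideal_lie x x = 0.
Proof. by apply: val_inj; exact: liexx. Qed.
Fact ideal_jacobi x y z :
  ideal_lie x (ideal_lie y z) + ideal_lie y (ideal_lie z x)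
    + ideal_lie z (ideal_lie x y) = 0.
Proof. by apply: val_inj; exact: lie_jacobi. Qed.
HB.instance Definition _ := Lmodule_isLieAlgebra.Build k ideal_sub
  ideal_lieDl ideal_lieDr ideal_liexx ideal_jacobi.
End LieQuotient.


(* The free Lie algebra on X: formal Lie expressions in the elements of X,     *)
(* modulo the least congruence imposing the axioms of Lie algebras.            *)

Inductive lie_term (k : comNzRingType) (X : Type) : Type :=
  | LGen of X
  | LZero
  | LAdd of lie_term k X & lie_term k X
  | LOpp of lie_term k X
  | LScale of k & lie_term k X
  | LBracket of lie_term k X & lie_term k X.
Arguments LGen {k X}.
Arguments LZero {k X}.

Section FreeLie.
Variables (k : comNzRingType) (X : Type).
Local Notation T := (lie_term k X).

Inductive lie_cong : T -> T -> Prop :=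
  | LC_refl t : lie_cong t t
  | LC_sym s t : lie_cong s t -> lie_cong t s
  | LC_trans s t u : lie_cong s t -> lie_cong t u -> lie_cong s u
  | LC_add s s' t t' : lie_cong s s' -> lie_cong t t' ->
      lie_cong (LAdd s t) (LAdd s' t')
  | LC_opp s s' : lie_cong s s' -> lie_cong (LOpp s) (LOpp s')
  | LC_scale a s s' : lie_cong s s' -> lie_cong (LScale a s) (LScale a s')
  | LC_bracket s s' t t' : lie_cong s s' -> lie_cong t t' ->
      lie_cong (LBracket s t) (LBracket s' t')
  | LC_addA s t u : lie_cong (LAdd s (LAdd t u)) (LAdd (LAdd s t) u)
  | LC_addC s t : lie_cong (LAdd s t) (LAdd t s)
  | LC_add0 s : lie_cong (LAdd LZero s) s
  | LC_addN s : lie_cong (LAdd (LOpp s) s) LZero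
  | LC_scaleA a b s : lie_cong (LScale a (LScale b s)) (LScale (a * b) s)
  | LC_scale1 s : lie_cong (LScale 1 s) s
  | LC_scaleDr a s t :
      lie_cong (LScale a (LAdd s t)) (LAdd (LScale a s) (LScale a t))
  | LC_scaleDl a b s :
      lie_cong (LScale (a + b) s) (LAdd (LScale a s) (LScale b s))
  | LC_bracketDl a s t u :
      lie_cong (LBracket (LAdd (LScale a s) t) u)
               (LAdd (LScale a (LBracket s u)) (LBracket t u))
  | LC_bracketDr a s t u :
      lie_cong (LBracket u (LAdd (LScale a s) t))
               (LAdd (LScale a (LBracket u s)) (LBracket u t))
  | LC_bracketxx s : lie_cong (LBracket s s) LZero
  | LC_jacobi s t u :
      lie_cong (LAdd (LAdd (LBracket s (LBracket t u)) (LBracket t (LBracket u s)))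
                     (LBracket u (LBracket s t))) LZero.

HB.instance Definition _ := gen_eqMixin T.
HB.instance Definition _ := gen_choiceMixin T.

Definition lie_congb (s t : T) : bool := `[< lie_cong s t >].

Fact lie_congb_equiv : equiv_class_of lie_congb.
Proof.
split=> [t|s t|t s u].
- exact/asboolP/LC_refl.
- by apply/asboolP/asboolP; apply: LC_sym.
- by move=> /asboolP st /asboolP tu; apply/asboolP; apply: LC_trans tu.
Qed.
Canonical lie_cong_equiv := EquivRelPack lie_congb_equiv.

Definition freelie : Type := {eq_quot lie_congb}.
HB.instance Definition _ := Choice.on freelie.

Definition freelie_class (t : T) : freelie := \pi_({eq_quot lie_congb}) t.
Definition freelie_repr (u : freelie) : T := repr (u : {eq_quot lie_congb}).

Lemma freelie_reprK u : freelie_class (freelie_repr u) = u.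
Proof. exact: reprK. Qed.

Lemma freelie_classP (P : freelie -> Prop) :
  (forall t, P (freelie_class t)) -> forall u, P u.
Proof. by move=> H u; rewrite -[u]freelie_reprK. Qed.

Lemma freelie_class_eq s t : freelie_class s = freelie_class t <-> lie_cong s t.
Proof. by split=> [/eqmodP/asboolP|H] //; apply/eqmodP/asboolP. Qed.

Lemma freelie_repr_class t : lie_cong (freelie_repr (freelie_class t)) t.
Proof. by apply/freelie_class_eq; rewrite freelie_reprK. Qed.

Definition freelie_zero := freelie_class LZero.
Definition freelie_add u v :=
  freelie_class (LAdd (freelie_repr u) (freelie_repr v)).
Definition freelie_opp u := freelie_class (LOpp (freelie_repr u)).
Definition freelie_scale a u := freelie_class (LScale a (freelie_repr u)).
Definition freelie_lie u v :=
  freelie_class (LBracket (freelie_repr u) (freelie_repr v)).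

Lemma freelie_addE s t :
  freelie_add (freelie_class s) (freelie_class t) = freelie_class (LAdd s t).
Proof. by apply/freelie_class_eq/LC_add; apply: freelie_repr_class. Qed.
Lemma freelie_oppE s : freelie_opp (freelie_class s) = freelie_class (LOpp s).
Proof. by apply/freelie_class_eq/LC_opp; apply: freelie_repr_class. Qed.
Lemma freelie_scaleE a s :
  freelie_scale a (freelie_class s) = freelie_class (LScale a s).
Proof. by apply/freelie_class_eq/LC_scale; apply: freelie_repr_class. Qed.
Lemma freelie_lieE s t :
  freelie_lie (freelie_class s) (freelie_class t) = freelie_class (LBracket s t).
Proof. by apply/freelie_class_eq/LC_bracket; apply: freelie_repr_class. Qed.

Let opE := (freelie_addE, freelie_oppE, freelie_scaleE, freelie_lieE).

Fact freelie_addA : associative freelie_add.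
Proof.
elim/freelie_classP=> s; elim/freelie_classP=> t; elim/freelie_classP=> u.
by rewrite !opE; apply/freelie_class_eq/LC_addA.
Qed.
Fact freelie_addC : commutative freelie_add.
Proof.
elim/freelie_classP=> s; elim/freelie_classP=> t.
by rewrite !opE; apply/freelie_class_eq/LC_addC.
Qed.
Fact freelie_add0 : left_id freelie_zero freelie_add.
Proof.
by elim/freelie_classP=> s; rewrite !opE; apply/freelie_class_eq/LC_add0.
Qed.
Fact freelie_addN : left_inverse freelie_zero freelie_opp freelie_add.
Proof.
by elim/freelie_classP=> s; rewrite !opE; apply/freelie_class_eq/LC_addN.
Qed.
HB.instance Definition _ := GRing.isZmodule.Build freelie
  freelie_addA freelie_addC freelie_add0 freelie_addN.

Fact freelie_scaleA a b u :
  freelie_scale a (freelie_scale b u) = freelie_scale (a * b) u.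
Proof.
by elim/freelie_classP: u => s; rewrite !opE; apply/freelie_class_eq/LC_scaleA.
Qed.
Fact freelie_scale1 : left_id 1 freelie_scale.
Proof.
by elim/freelie_classP=> s; rewrite !opE; apply/freelie_class_eq/LC_scale1.
Qed.
Fact freelie_scaleDr : right_distributive freelie_scale +%R.
Proof.
move=> a; elim/freelie_classP=> s; elim/freelie_classP=> t.
by rewrite /+%R/= !opE; apply/freelie_class_eq/LC_scaleDr.
Qed.
Fact freelie_scaleDl u : {morph freelie_scale^~ u : a b / a + b}.
Proof.
move=> a b; elim/freelie_classP: u => s.
by rewrite [RHS]/+%R/= !opE; apply/freelie_class_eq/LC_scaleDl.
Qed.
HB.instance Definition _ := GRing.Zmodule_isLmodule.Build k freelie
  freelie_scaleA freelie_scale1 freelie_scaleDr freelie_scaleDl.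

Lemma freelie_class0 : freelie_class LZero = 0. Proof. by []. Qed.
Lemma freelie_classD s t :
  freelie_class (LAdd s t) = freelie_class s + freelie_class t.
Proof. by rewrite -freelie_addE. Qed.
Lemma freelie_classN s : freelie_class (LOpp s) = - freelie_class s.
Proof. by rewrite -freelie_oppE. Qed.
Lemma freelie_classZ a s : freelie_class (LScale a s) = a *: freelie_class s.
Proof. by rewrite -freelie_scaleE. Qed.

Fact freelie_lieDl a x y z :
  freelie_lie (a *: x + y) z = a *: freelie_lie x z + freelie_lie y z.
Proof.
elim/freelie_classP: x => s; elim/freelie_classP: y => t.
elim/freelie_classP: z => u; rewrite -freelie_classZ -freelie_classD.
rewrite !freelie_lieE -freelie_classZ -freelie_classD.
exact/freelie_class_eq/LC_bracketDl.
Qed.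
Fact freelie_lieDr a x y z :
  freelie_lie z (a *: x + y) = a *: freelie_lie z x + freelie_lie z y.
Proof.
elim/freelie_classP: x => s; elim/freelie_classP: y => t.
elim/freelie_classP: z => u; rewrite -freelie_classZ -freelie_classD.
rewrite !freelie_lieE -freelie_classZ -freelie_classD.
exact/freelie_class_eq/LC_bracketDr.
Qed.
Fact freelie_liexx x : freelie_lie x x = 0.
Proof.
elim/freelie_classP: x => s; rewrite freelie_lieE.
exact/freelie_class_eq/LC_bracketxx.
Qed.
Fact freelie_jacobi x y z :
  freelie_lie x (freelie_lie y z) + freelie_lie y (freelie_lie z x)
    + freelie_lie z (freelie_lie x y) = 0.
Proof.
elim/freelie_classP: x => s; elim/freelie_classP: y => t.
elim/freelie_classP: z => u; rewrite !freelie_lieE -!freelie_classD.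
exact/freelie_class_eq/LC_jacobi.
Qed.
HB.instance Definition _ := Lmodule_isLieAlgebra.Build k freelie
  freelie_lieDl freelie_lieDr freelie_liexx freelie_jacobi.

Lemma freelie_classL s t :
  freelie_class (LBracket s t) = ⁅freelie_class s, freelie_class t⁆.
Proof. by rewrite -freelie_lieE. Qed.

Definition freelie_gen (x : X) : freelie := freelie_class (LGen x).

Section Lift.
Variables (L : liealgType k) (f : X -> L).

Fixpoint lie_eval (t : T) : L :=
  match t with
  | LGen x => f x
  | LZero => 0
  | LAdd s t => lie_eval s + lie_eval t
  | LOpp s => - lie_eval s
  | LScale a s => a *: lie_eval s
  | LBracket s t => ⁅lie_eval s, lie_eval t⁆
  end.

Lemma lie_eval_cong s t : lie_cong s t -> lie_eval s = lie_eval t.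
Proof.
elim=> {s t} //=; try by move=> *; congruence.
- by move=> *; rewrite addrA.
- by move=> *; rewrite addrC.
- by move=> *; rewrite add0r.
- by move=> *; rewrite addNr.
- by move=> *; rewrite scalerA.
- by move=> *; rewrite scale1r.
- by move=> *; rewrite scalerDr.
- by move=> *; rewrite scalerDl.
- by move=> *; rewrite lieDl.
- by move=> *; rewrite lieDr.
- by move=> *; rewrite liexx.
- by move=> *; rewrite lie_jacobi.
Qed.

Definition freelie_lift (u : freelie) : L := lie_eval (freelie_repr u).

Lemma freelie_liftE t : freelie_lift (freelie_class t) = lie_eval t.
Proof. exact/lie_eval_cong/freelie_repr_class. Qed.

Fact freelie_lift_linear : linear freelie_lift.
Proof.
move=> a; elim/freelie_classP=> s; elim/freelie_classP=> t.
by rewrite -freelie_classZ -freelie_classD !freelie_liftE.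
Qed.
HB.instance Definition _ :=
  GRing.isLinear.Build k freelie L *:%R freelie_lift freelie_lift_linear.

Fact freelie_lift_lie : {morph freelie_lift : x y / ⁅x, y⁆}.
Proof.
elim/freelie_classP=> s; elim/freelie_classP=> t.
by rewrite -freelie_classL !freelie_liftE.
Qed.
HB.instance Definition _ :=
  isLieMorphism.Build k freelie L freelie_lift freelie_lift_lie.

Lemma freelie_lift_gen x : freelie_lift (freelie_gen x) = f x.
Proof. exact: freelie_liftE. Qed.

Lemma freelie_lift_unique (g : lieHom freelie L) :
  (forall x, g (freelie_gen x) = f x) -> g =1 freelie_lift.
Proof.
move=> gf; elim/freelie_classP; elim=> [x||s IHs t IHt|s IHs|a s IHs|s IHs t IHt].
- by rewrite gf freelie_liftE.
- by rewrite freelie_class0 !linear0.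
- by rewrite freelie_classD !linearD/= IHs IHt.
- by rewrite freelie_classN !linearN/= IHs.
- by rewrite freelie_classZ !linearZ/= IHs.
- by rewrite freelie_classL !lie_morph IHs IHt.
Qed.
End Lift.
End FreeLie.
Arguments freelie_gen {k X}.

Definition freelie_map (k : comNzRingType) (X Y : Type) (f : X -> Y) :
    freelie k X -> freelie k Y :=
  freelie_lift (fun x => freelie_gen (f x)).
HB.instance Definition _ (k : comNzRingType) (X Y : Type) (f : X -> Y) :=
  LieMorphism.on (@freelie_map k X Y f).

Lemma freelie_map_gen (k : comNzRingType) (X Y : Type) (f : X -> Y) (x : X) :
  freelie_map f (freelie_gen x) = freelie_gen (f x) :> freelie k Y.
Proof. exact: freelie_lift_gen. Qed.

(* The universal enveloping algebra: the free unital associative k-algebra on  *)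
(* the set L, modulo the relations making the inclusion of L linear and        *)
(* sending the bracket to the commutator.                                      *)

Inductive uenv_term (k : comNzRingType) (L : Type) : Type :=
  | UIn of L
  | UZero
  | UAdd of uenv_term k L & uenv_term k L
  | UOpp of uenv_term k L
  | UScale of k & uenv_term k L
  | UOne
  | UMul of uenv_term k L & uenv_term k L.
Arguments UIn {k L}.
Arguments UZero {k L}.
Arguments UOne {k L}.

Section Enveloping.
Variables (k : comNzRingType) (L : liealgType k).
Local Notation T := (uenv_term k L).

Inductive uenv_cong : T -> T -> Prop :=
  | UC_refl t : uenv_cong t t
  | UC_sym s t : uenv_cong s t -> uenv_cong t s
  | UC_trans s t u : uenv_cong s t -> uenv_cong t u -> uenv_cong s u
  | UC_add s s' t t' : uenv_cong s s' -> uenv_cong t t' ->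
      uenv_cong (UAdd s t) (UAdd s' t')
  | UC_opp s s' : uenv_cong s s' -> uenv_cong (UOpp s) (UOpp s')
  | UC_scale a s s' : uenv_cong s s' -> uenv_cong (UScale a s) (UScale a s')
  | UC_mul s s' t t' : uenv_cong s s' -> uenv_cong t t' ->
      uenv_cong (UMul s t) (UMul s' t')
  | UC_addA s t u : uenv_cong (UAdd s (UAdd t u)) (UAdd (UAdd s t) u)
  | UC_addC s t : uenv_cong (UAdd s t) (UAdd t s)
  | UC_add0 s : uenv_cong (UAdd UZero s) s
  | UC_addN s : uenv_cong (UAdd (UOpp s) s) UZero
  | UC_scaleA a b s : uenv_cong (UScale a (UScale b s)) (UScale (a * b) s)
  | UC_scale1 s : uenv_cong (UScale 1 s) s
  | UC_scaleDr a s t :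
      uenv_cong (UScale a (UAdd s t)) (UAdd (UScale a s) (UScale a t))
  | UC_scaleDl a b s :
      uenv_cong (UScale (a + b) s) (UAdd (UScale a s) (UScale b s))
  | UC_mulA s t u : uenv_cong (UMul s (UMul t u)) (UMul (UMul s t) u)
  | UC_mul1l s : uenv_cong (UMul UOne s) s
  | UC_mul1r s : uenv_cong (UMul s UOne) s
  | UC_mulDl s t u : uenv_cong (UMul (UAdd s t) u) (UAdd (UMul s u) (UMul t u))
  | UC_mulDr s t u : uenv_cong (UMul s (UAdd t u)) (UAdd (UMul s t) (UMul s u))
  | UC_scaleAl a s t : uenv_cong (UScale a (UMul s t)) (UMul (UScale a s) t)
  | UC_scaleAr a s t : uenv_cong (UScale a (UMul s t)) (UMul s (UScale a t))
  | UC_in_linear a x y :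
      uenv_cong (UIn (a *: x + y)) (UAdd (UScale a (UIn x)) (UIn y))
  | UC_in_lie x y :
      uenv_cong (UIn ⁅x, y⁆)
                (UAdd (UMul (UIn x) (UIn y)) (UOpp (UMul (UIn y) (UIn x)))).

HB.instance Definition _ := gen_eqMixin T.
HB.instance Definition _ := gen_choiceMixin T.

Definition uenv_congb (s t : T) : bool := `[< uenv_cong s t >].

Fact uenv_congb_equiv : equiv_class_of uenv_congb.
Proof.
split=> [t|s t|t s u].
- exact/asboolP/UC_refl.
- by apply/asboolP/asboolP; apply: UC_sym.
- by move=> /asboolP st /asboolP tu; apply/asboolP; apply: UC_trans tu.
Qed.
Canonical uenv_cong_equiv := EquivRelPack uenv_congb_equiv.

Definition uenv : Type := {eq_quot uenv_congb}.
HB.instance Definition _ := Choice.on uenv.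

Definition uenv_class (t : T) : uenv := \pi_({eq_quot uenv_congb}) t.
Definition uenv_repr (u : uenv) : T := repr (u : {eq_quot uenv_congb}).

Lemma uenv_reprK u : uenv_class (uenv_repr u) = u.
Proof. exact: reprK. Qed.

Lemma uenv_classP (P : uenv -> Prop) :
  (forall t, P (uenv_class t)) -> forall u, P u.
Proof. by move=> H u; rewrite -[u]uenv_reprK. Qed.

Lemma uenv_class_eq s t : uenv_class s = uenv_class t <-> uenv_cong s t.
Proof. by split=> [/eqmodP/asboolP|H] //; apply/eqmodP/asboolP. Qed.

Lemma uenv_repr_class t : uenv_cong (uenv_repr (uenv_class t)) t.
Proof. by apply/uenv_class_eq; rewrite uenv_reprK. Qed.

Definition uenv_zero := uenv_class UZero.
Definition uenv_one := uenv_class UOne.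
Definition uenv_add u v := uenv_class (UAdd (uenv_repr u) (uenv_repr v)).
Definition uenv_opp u := uenv_class (UOpp (uenv_repr u)).
Definition uenv_scale a u := uenv_class (UScale a (uenv_repr u)).
Definition uenv_mul u v := uenv_class (UMul (uenv_repr u) (uenv_repr v)).

Lemma uenv_addE s t :
  uenv_add (uenv_class s) (uenv_class t) = uenv_class (UAdd s t).
Proof. by apply/uenv_class_eq/UC_add; apply: uenv_repr_class. Qed.
Lemma uenv_oppE s : uenv_opp (uenv_class s) = uenv_class (UOpp s).
Proof. by apply/uenv_class_eq/UC_opp; apply: uenv_repr_class. Qed.
Lemma uenv_scaleE a s : uenv_scale a (uenv_class s) = uenv_class (UScale a s).
Proof. by apply/uenv_class_eq/UC_scale; apply: uenv_repr_class. Qed.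
Lemma uenv_mulE s t :
  uenv_mul (uenv_class s) (uenv_class t) = uenv_class (UMul s t).
Proof. by apply/uenv_class_eq/UC_mul; apply: uenv_repr_class. Qed.

Let opE := (uenv_addE, uenv_oppE, uenv_scaleE, uenv_mulE).

Fact uenv_addA : associative uenv_add.
Proof.
elim/uenv_classP=> s; elim/uenv_classP=> t; elim/uenv_classP=> u.
by rewrite !opE; apply/uenv_class_eq/UC_addA.
Qed.
Fact uenv_addC : commutative uenv_add.
Proof.
elim/uenv_classP=> s; elim/uenv_classP=> t.
by rewrite !opE; apply/uenv_class_eq/UC_addC.
Qed.
Fact uenv_add0 : left_id uenv_zero uenv_add.
Proof. by elim/uenv_classP=> s; rewrite !opE; apply/uenv_class_eq/UC_add0. Qed.
Fact uenv_addN : left_inverse uenv_zero uenv_opp uenv_add.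
Proof. by elim/uenv_classP=> s; rewrite !opE; apply/uenv_class_eq/UC_addN. Qed.
HB.instance Definition _ :=
  GRing.isZmodule.Build uenv uenv_addA uenv_addC uenv_add0 uenv_addN.

Lemma uenv_class0 : uenv_class UZero = 0. Proof. by []. Qed.
Lemma uenv_classD s t : uenv_class (UAdd s t) = uenv_class s + uenv_class t.
Proof. by rewrite -uenv_addE. Qed.
Lemma uenv_classN s : uenv_class (UOpp s) = - uenv_class s.
Proof. by rewrite -uenv_oppE. Qed.

Fact uenv_scaleA a b u : uenv_scale a (uenv_scale b u) = uenv_scale (a * b) u.
Proof.
by elim/uenv_classP: u => s; rewrite !opE; apply/uenv_class_eq/UC_scaleA.
Qed.
Fact uenv_scale1 : left_id 1 uenv_scale.
Proof. by elim/uenv_classP=> s; rewrite !opE; apply/uenv_class_eq/UC_scale1. Qed.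
Fact uenv_scaleDr : right_distributive uenv_scale +%R.
Proof.
move=> a; elim/uenv_classP=> s; elim/uenv_classP=> t.
by rewrite -uenv_classD !opE -uenv_classD; apply/uenv_class_eq/UC_scaleDr.
Qed.
Fact uenv_scaleDl u : {morph uenv_scale^~ u : a b / a + b}.
Proof.
move=> a b; elim/uenv_classP: u => s.
by rewrite !opE -uenv_classD; apply/uenv_class_eq/UC_scaleDl.
Qed.
HB.instance Definition _ := GRing.Zmodule_isLmodule.Build k uenv
  uenv_scaleA uenv_scale1 uenv_scaleDr uenv_scaleDl.

Lemma uenv_classZ a s : uenv_class (UScale a s) = a *: uenv_class s.
Proof. by rewrite -uenv_scaleE. Qed.

Fact uenv_mulA : associative uenv_mul.
Proof.
elim/uenv_classP=> s; elim/uenv_classP=> t; elim/uenv_classP=> u.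
by rewrite !opE; apply/uenv_class_eq/UC_mulA.
Qed.
Fact uenv_mul1l : left_id uenv_one uenv_mul.
Proof. by elim/uenv_classP=> s; rewrite !opE; apply/uenv_class_eq/UC_mul1l. Qed.
Fact uenv_mul1r : right_id uenv_one uenv_mul.
Proof. by elim/uenv_classP=> s; rewrite !opE; apply/uenv_class_eq/UC_mul1r. Qed.
Fact uenv_mulDl : left_distributive uenv_mul +%R.
Proof.
elim/uenv_classP=> s; elim/uenv_classP=> t; elim/uenv_classP=> u.
by rewrite -uenv_classD !opE -uenv_classD; apply/uenv_class_eq/UC_mulDl.
Qed.
Fact uenv_mulDr : right_distributive uenv_mul +%R.
Proof.
elim/uenv_classP=> s; elim/uenv_classP=> t; elim/uenv_classP=> u.
by rewrite -uenv_classD !opE -uenv_classD; apply/uenv_class_eq/UC_mulDr.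
Qed.

Fixpoint uenv_aug (t : T) : k :=
  match t with
  | UIn _ => 0
  | UZero => 0
  | UAdd s t => uenv_aug s + uenv_aug t
  | UOpp s => - uenv_aug s
  | UScale a s => a * uenv_aug s
  | UOne => 1
  | UMul s t => uenv_aug s * uenv_aug t
  end.

Lemma uenv_aug_cong s t : uenv_cong s t -> uenv_aug s = uenv_aug t.
Proof.
elim=> {s t} //=; try by move=> *; congruence.
- by move=> *; rewrite addrA.
- by move=> *; rewrite addrC.
- by move=> *; rewrite add0r.
- by move=> *; rewrite addNr.
- by move=> *; rewrite mulrA.
- by move=> *; rewrite mul1r.
- by move=> *; rewrite mulrDr.
- by move=> *; rewrite mulrDl.
- by move=> *; rewrite mulrA.
- by move=> *; rewrite mul1r.
- by move=> *; rewrite mulr1.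
- by move=> *; rewrite mulrDl.
- by move=> *; rewrite mulrDr.
- by move=> *; rewrite mulrA.
- by move=> *; rewrite mulrCA.
- by move=> *; rewrite mulr0 addr0.
- by move=> *; rewrite mulr0 subr0.
Qed.

Fact uenv_one_neq0 : uenv_one != 0.
Proof.
apply/eqP; rewrite -uenv_class0 => /uenv_class_eq /uenv_aug_cong /= /eqP.
by rewrite oner_eq0.
Qed.
HB.instance Definition _ := GRing.Zmodule_isNzRing.Build uenv
  uenv_mulA uenv_mul1l uenv_mul1r uenv_mulDl uenv_mulDr uenv_one_neq0.

Lemma uenv_class1 : uenv_class UOne = 1. Proof. by []. Qed.
Lemma uenv_classM s t : uenv_class (UMul s t) = uenv_class s * uenv_class t.
Proof. by rewrite -uenv_mulE. Qed.

Fact uenv_scaleAl (a : k) (u v : uenv) : a *: (u * v) = (a *: u) * v.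
Proof.
elim/uenv_classP: u => s; elim/uenv_classP: v => t.
rewrite -uenv_classM -!uenv_classZ -uenv_classM.
exact/uenv_class_eq/UC_scaleAl.
Qed.
HB.instance Definition _ := GRing.Lmodule_isLalgebra.Build k uenv uenv_scaleAl.

Fact uenv_scaleAr (a : k) (u v : uenv) : a *: (u * v) = u * (a *: v).
Proof.
elim/uenv_classP: u => s; elim/uenv_classP: v => t.
rewrite -uenv_classM -!uenv_classZ -uenv_classM.
exact/uenv_class_eq/UC_scaleAr.
Qed.
HB.instance Definition _ := GRing.Lalgebra_isAlgebra.Build k uenv uenv_scaleAr.

Definition uenv_in (x : L) : uenv := uenv_class (UIn x).

Fact uenv_in_linear : linear uenv_in.
Proof.
move=> a x y; rewrite -uenv_classZ -uenv_classD.
exact/uenv_class_eq/UC_in_linear.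
Qed.
HB.instance Definition _ :=
  GRing.isLinear.Build k L uenv *:%R uenv_in uenv_in_linear.

Lemma uenv_in_lie x y :
  uenv_in ⁅x, y⁆ = uenv_in x * uenv_in y - uenv_in y * uenv_in x.
Proof.
rewrite -!uenv_classM -uenv_classN -uenv_classD.
exact/uenv_class_eq/UC_in_lie.
Qed.

Section Lift.
Variables (A : algType k) (f : {linear L -> A}).
Hypothesis fL : forall x y, f ⁅x, y⁆ = f x * f y - f y * f x.

Fixpoint uenv_eval (t : T) : A :=
  match t with
  | UIn x => f x
  | UZero => 0
  | UAdd s t => uenv_eval s + uenv_eval t
  | UOpp s => - uenv_eval s
  | UScale a s => a *: uenv_eval s
  | UOne => 1
  | UMul s t => uenv_eval s * uenv_eval t
  end.

Lemma uenv_eval_cong s t : uenv_cong s t -> uenv_eval s = uenv_eval t.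
Proof.
elim=> {s t} //=; try by move=> *; congruence.
- by move=> *; rewrite addrA.
- by move=> *; rewrite addrC.
- by move=> *; rewrite add0r.
- by move=> *; rewrite addNr.
- by move=> *; rewrite scalerA.
- by move=> *; rewrite scale1r.
- by move=> *; rewrite scalerDr.
- by move=> *; rewrite scalerDl.
- by move=> *; rewrite mulrA.
- by move=> *; rewrite mul1r.
- by move=> *; rewrite mulr1.
- by move=> *; rewrite mulrDl.
- by move=> *; rewrite mulrDr.
- by move=> *; rewrite scalerAl.
- by move=> *; rewrite scalerAr.
- by move=> *; rewrite linearP.
Qed.

Definition uenv_lift (u : uenv) : A := uenv_eval (uenv_repr u).

Lemma uenv_liftE t : uenv_lift (uenv_class t) = uenv_eval t.
Proof. exact/uenv_eval_cong/uenv_repr_class. Qed.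

Lemma uenv_lift_in x : uenv_lift (uenv_in x) = f x.
Proof. exact: uenv_liftE. Qed.

Lemma uenv_lift_linear : linear uenv_lift.
Proof.
move=> a; elim/uenv_classP=> s; elim/uenv_classP=> t.
by rewrite -uenv_classZ -uenv_classD !uenv_liftE.
Qed.

Lemma uenv_lift_multiplicative : monoid_morphism uenv_lift.
Proof.
split; first by rewrite -uenv_class1 uenv_liftE.
elim/uenv_classP=> s; elim/uenv_classP=> t.
by rewrite -uenv_classM !uenv_liftE.
Qed.

Lemma uenv_lift_unique (g : {lrmorphism uenv -> A}) :
  (forall x, g (uenv_in x) = f x) -> g =1 uenv_lift.
Proof.
move=> gf; elim/uenv_classP=> t; rewrite uenv_liftE.
elim: t => [x||s IHs t IHt|s IHs|a s IHs||s IHs t IHt].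
- exact: gf.
- by rewrite uenv_class0 rmorph0.
- by rewrite uenv_classD rmorphD/= IHs IHt.
- by rewrite uenv_classN rmorphN/= IHs.
- by rewrite uenv_classZ linearZ/= IHs.
- by rewrite uenv_class1 rmorph1.
- by rewrite uenv_classM rmorphM/= IHs IHt.
Qed.
End Lift.

(* An L-module M becomes a U(L)-module; the action is evaluated on terms. *)
Section Action.
Variables (M : lmodType k) (act : L -> M -> M).
Hypothesis actP : forall x, linear (act x).
Hypothesis act_linear : forall m, linear (act^~ m).
Hypothesis act_lie : forall x y m, act ⁅x, y⁆ m = act x (act y m) - act y (act x m).

Fixpoint uenv_act_term (t : T) (m : M) : M :=
  match t with
  | UIn x => act x m
  | UZero => 0
  | UAdd s t => uenv_act_term s m + uenv_act_term t m
  | UOpp s => - uenv_act_term s m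
  | UScale a s => a *: uenv_act_term s m
  | UOne => m
  | UMul s t => uenv_act_term s (uenv_act_term t m)
  end.

Lemma uenv_act_term_linear t : linear (uenv_act_term t).
Proof.
elim: t => [x||s IHs t IHt|s IHs|b s IHs||s IHs t IHt] a m n //=.
- exact: actP.
- by rewrite scaler0 addr0.
- by rewrite IHs IHt scalerDr addrACA.
- by rewrite IHs opprD scalerN.
- by rewrite IHs scalerDr !scalerA mulrC.
- by rewrite IHt IHs.
Qed.

Lemma uenv_act_term_cong s t :
  uenv_cong s t -> forall m, uenv_act_term s m = uenv_act_term t m.
Proof.
have actD u m n : uenv_act_term u (m + n) = uenv_act_term u m + uenv_act_term u n.
  by have := uenv_act_term_linear u 1 m n; rewrite !scale1r.
have act0 u : uenv_act_term u 0 = 0.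
  by apply: (addrI (uenv_act_term u 0)); rewrite -actD !addr0.
have actZ u a m : uenv_act_term u (a *: m) = a *: uenv_act_term u m.
  by rewrite -[a *: m]addr0 uenv_act_term_linear act0 addr0.
elim=> {s t} //=; try by move=> *; congruence.
- by move=> *; rewrite addrA.
- by move=> *; rewrite addrC.
- by move=> *; rewrite add0r.
- by move=> *; rewrite addNr.
- by move=> *; rewrite scalerA.
- by move=> *; rewrite scale1r.
- by move=> *; rewrite scalerDr.
- by move=> *; rewrite scalerDl.
- by move=> a x y m; rewrite act_linear.
Qed.

Definition uenv_act (u : uenv) (m : M) : M := uenv_act_term (uenv_repr u) m.

Lemma uenv_actE t m : uenv_act (uenv_class t) m = uenv_act_term t m.
Proof. exact/uenv_act_term_cong/uenv_repr_class. Qed.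

Lemma uenv_act_in x m : uenv_act (uenv_in x) m = act x m.
Proof. exact: uenv_actE. Qed.

Lemma uenv_actA u v m : uenv_act u (uenv_act v m) = uenv_act (u * v) m.
Proof.
by elim/uenv_classP: u => s; elim/uenv_classP: v => t; rewrite -uenv_classM !uenv_actE.
Qed.
Lemma uenv_act1 : left_id 1 uenv_act.
Proof. by move=> m; rewrite -uenv_class1 uenv_actE. Qed.
Lemma uenv_actDr : right_distributive uenv_act +%R.
Proof.
move=> u m n; have := uenv_act_term_linear (uenv_repr u) 1 m n.
by rewrite !scale1r.
Qed.
Lemma uenv_actDl m : {morph uenv_act^~ m : u v / u + v}.
Proof.
elim/uenv_classP=> s; elim/uenv_classP=> t.
by rewrite -uenv_classD !uenv_actE.
Qed.
End Action.
End Enveloping.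

Section EnvelopingMap.
Variables (k : comNzRingType) (L M : liealgType k) (f : lieHom L M).

Definition uenv_map : uenv L -> uenv M := uenv_lift (uenv_in (L := M) \o f).

Fact uenv_map_comm x y : (uenv_in (L := M) \o f) ⁅x, y⁆ =
  (uenv_in (L := M) \o f) x * (uenv_in (L := M) \o f) y
    - (uenv_in (L := M) \o f) y * (uenv_in (L := M) \o f) x.
Proof. by rewrite /= lie_morph uenv_in_lie. Qed.

HB.instance Definition _ := GRing.isLinear.Build k (uenv L) (uenv M) *:%R
  uenv_map (uenv_lift_linear uenv_map_comm).
HB.instance Definition _ := GRing.isMonoidMorphism.Build (uenv L) (uenv M)
  uenv_map (uenv_lift_multiplicative uenv_map_comm).

Lemma uenv_map_in x : uenv_map (uenv_in x) = uenv_in (f x).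
Proof. exact: (uenv_lift_in uenv_map_comm). Qed.
End EnvelopingMap.

Definition abelianization (k : comNzRingType) (L : liealgType k) : liealgType k :=
  lie_quot (derived L).

Record presentation (k : comNzRingType) : Type := Presentation {
  gens : finType;
  nrel : nat;
  relators : nrel.-tuple (freelie k gens)
}.

Section Presentation.
Variables (k : comNzRingType) (P : presentation k).
Local Notation F := (freelie k (gens P)).

Definition rel_ideal : lieIdeal F :=
  ideal_gen [set r | r \in relators P].

(* G = F / R *)
Definition presented : liealgType k := lie_quot rel_ideal.

(* R^ab = R / [R, R] *)
Definition relmod : Type := abelianization (ideal_sub rel_ideal).
HB.instance Definition _ := GRing.Zmodule.on relmod.

Definition relmod_proj (r : ideal_sub rel_ideal) : relmod :=
  lie_proj (derived _) r.

Lemma relmod_projP (Q : relmod -> Prop) :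
  (forall r, Q (relmod_proj r)) -> forall m, Q m.
Proof. exact: lie_projP. Qed.

Local Notation RabL := (abelianization (ideal_sub rel_ideal)).

(* The action of G on R^ab induced by the adjoint action of F on R. *)
Definition relmod_ad (g : presented) (m : RabL) : RabL :=
  lie_proj (derived _) (ideal_act (lie_repr g) (lie_repr m)).

Fact ideal_act_linear (x : F) : linear (@ideal_act k F rel_ideal x).
Proof. by move=> a r s; apply: val_inj; exact: lieDr. Qed.

Fact ideal_act_derived (x : F) (r : ideal_sub rel_ideal) :
  r \in derived _ -> ideal_act x r \in derived _.
Proof.
move=> /asboolP Ir; apply/asboolP => I /= [[I0 IZ] sI].
pose J : set (ideal_sub rel_ideal) := [set r | I r /\ I (ideal_act x r)].
suff: J r by case.
apply: (Ir J); split=> [|t [u _ [v _ <-]]].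
  split=> [|a s t [Is Js] [It Jt]].
    split=> //; suff -> : ideal_act x (0 : ideal_sub rel_ideal) = 0 by [].
    by apply: val_inj; exact: liex0.
  by split; [apply: IZ|rewrite ideal_act_linear; apply: IZ].
split; first by apply: sI; exists u => //; exists v.
have -> : ideal_act x ⁅u, v⁆ = 1 *: ⁅ideal_act x u, v⁆ + ⁅u, ideal_act x v⁆.
  rewrite scale1r; apply: val_inj; rewrite raddfD/=.
  by rewrite lie_ad subrK.
by apply: IZ; apply: sI; [exists (ideal_act x u)|exists u] => //;
  [exists v|exists (ideal_act x v)].
Qed.

Lemma relmod_adE (x : F) (r : ideal_sub rel_ideal) :
  relmod_ad (lie_proj rel_ideal x) (lie_proj (derived _) r) =
  lie_proj (derived _) (ideal_act x r).
Proof.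
apply/lie_proj_eq; set x' := lie_repr _; set r' := lie_repr _.
have Rx : x' - x \in rel_ideal by apply: lie_repr_proj.
have -> : ideal_act x' r' - ideal_act x r =
    ⁅IdealSub Rx, r'⁆ + ideal_act x (r' - r).
  apply: val_inj; rewrite !raddfB raddfD/= lieDx liexD lieNx liexN.
  by rewrite addrA subrK.
by apply: rpredD; [apply: lie_derived|apply/ideal_act_derived/lie_repr_proj].
Qed.

Fact relmod_ad_linear g : linear (relmod_ad g).
Proof.
elim/lie_projP: g => x a; elim/lie_projP=> r; elim/lie_projP=> s.
by rewrite -linearP !relmod_adE ideal_act_linear linearP.
Qed.

Fact relmod_ad_linearl m : linear (relmod_ad^~ m).
Proof.
move=> a; elim/lie_projP=> x; elim/lie_projP=> y; elim/lie_projP: m => r.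
rewrite -linearP !relmod_adE -linearP; congr (lie_proj _ _).
by apply: val_inj; exact: lieDl.
Qed.

Fact relmod_ad_lie x y m :
  relmod_ad ⁅x, y⁆ m = relmod_ad x (relmod_ad y m) - relmod_ad y (relmod_ad x m).
Proof.
elim/lie_projP: x => x; elim/lie_projP: y => y; elim/lie_projP: m => r.
rewrite -lie_morph (relmod_adE x r) (relmod_adE y r) !relmod_adE -linearB; congr (lie_proj _ _).
by apply: val_inj; rewrite raddfB/=; exact: lie_ad.
Qed.

Definition relmod_scale (u : uenv presented) (m : relmod) : relmod :=
  uenv_act relmod_ad u m.

HB.instance Definition _ := GRing.Zmodule_isLmodule.Build (uenv presented) relmod
  (uenv_actA relmod_ad_linear relmod_ad_linearl relmod_ad_lie)
  (uenv_act1 relmod_ad_linear relmod_ad_linearl relmod_ad_lie)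
  (uenv_actDr relmod_ad_linear)
  (uenv_actDl relmod_ad_linear relmod_ad_linearl relmod_ad_lie).

Lemma relmod_scale_in (x : F) (r : ideal_sub rel_ideal) :
  uenv_in (lie_proj rel_ideal x) *: relmod_proj r = relmod_proj (ideal_act x r).
Proof.
by rewrite [LHS](uenv_act_in relmod_ad_linear relmod_ad_linearl relmod_ad_lie) relmod_adE.
Qed.

Lemma relmod_scale_scalar (a : k) (r : ideal_sub rel_ideal) :
  (a *: 1 : uenv presented) *: relmod_proj r = relmod_proj (a *: r).
Proof.
rewrite -uenv_class1 -uenv_classZ.
rewrite [LHS](uenv_actE relmod_ad_linear relmod_ad_linearl relmod_ad_lie)/=.
by rewrite -[RHS]/(lie_proj _ _) linearZ.
Qed.

Fact mem_relator i : tnth (relators P) i \in rel_ideal.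
Proof. exact/mem_ideal_gen/mem_tnth. Qed.

Definition relator_class (i : 'I_(nrel P)) : relmod :=
  relmod_proj (IdealSub (mem_relator i)).

(* e_i is the row vector delta_mx 0 i *)
Definition rel_boundary (v : 'rV[uenv presented]_(nrel P)) : relmod :=
  \sum_i v 0 i *: relator_class i.

Fact rel_boundary_linear : linear rel_boundary.
Proof.
move=> a u v; rewrite /rel_boundary scaler_sumr -big_split/=.
by apply: eq_bigr => i _; rewrite !mxE scalerDl scalerA.
Qed.
HB.instance Definition _ := GRing.isLinear.Build (uenv presented)
  'rV[uenv presented]_(nrel P) relmod *:%R rel_boundary rel_boundary_linear.

Lemma rel_boundary_delta i : rel_boundary (delta_mx 0 i) = relator_class i.
Proof.
rewrite /rel_boundary (bigD1 i)//= mxE !eqxx scale1r big1 ?addr0// => j /negPf ji.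
by rewrite mxE ji scale0r.
Qed.

Definition Pi2 : set 'rV[uenv presented]_(nrel P) := [set v | rel_boundary v = 0].

Definition aspherical : Prop := Pi2 = [set 0].
End Presentation.
Arguments Pi2 {k} P _.

(* A subset of the generators or relators is given as an injection. *)
Record subpresentation (k : comNzRingType) (P Q : presentation k) : Type :=
  Subpresentation {
  sub_gen : gens P -> gens Q;
  sub_gen_inj : injective sub_gen;
  sub_rel : 'I_(nrel P) -> 'I_(nrel Q);
  sub_rel_inj : injective sub_rel;
  sub_relE : forall i,
    freelie_map sub_gen (tnth (relators P) i) = tnth (relators Q) (sub_rel i)
}.

Section Inclusion.
Variables (k : comNzRingType) (P Q : presentation k) (s : subpresentation P Q).
Local Notation phi := (@freelie_map k _ _ (sub_gen s)).

Fact freelie_map_rel x : x \in rel_ideal P -> phi x \in rel_ideal Q.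
Proof.
move=> /asboolP Ix.
apply: (Ix [set y | phi y \in rel_ideal Q]); split=> /= [|r].
  split; last by move=> y z /= Iz; rewrite lie_morph; exact: ideal_pred_stable.
  split=> [|a y z Iy Iz]; first by rewrite /= linear0 rpred0.
  by rewrite /= linearP rpredD// rpredZ.
by move/tnthP => [i ->]; rewrite /= sub_relE mem_relator.
Qed.

Definition presented_map (g : presented P) : presented Q :=
  lie_proj (rel_ideal Q) (phi (lie_repr g)).

Lemma presented_mapE x :
  presented_map (lie_proj (rel_ideal P) x) = lie_proj (rel_ideal Q) (phi x).
Proof.
apply/lie_proj_eq; rewrite -linearB.
exact/freelie_map_rel/lie_repr_proj.
Qed.

Fact presented_map_linear : linear presented_map.
Proof.
move=> a; elim/lie_projP=> x; elim/lie_projP=> y.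
by rewrite -linearP !presented_mapE !linearP.
Qed.
HB.instance Definition _ := GRing.isLinear.Build k (presented P) (presented Q)
  *:%R presented_map presented_map_linear.

Fact presented_map_lie : {morph presented_map : x y / ⁅x, y⁆}.
Proof.
elim/lie_projP=> x; elim/lie_projP=> y.
by rewrite -lie_morph !presented_mapE !lie_morph.
Qed.
HB.instance Definition _ := isLieMorphism.Build k (presented P) (presented Q)
  presented_map presented_map_lie.

(* u e_i |-> (uenv_map u) e_(sub_rel i), on the free modules *)
Definition Pi2_map (v : 'rV[uenv (presented P)]_(nrel P)) :
    'rV[uenv (presented Q)]_(nrel Q) :=
  \sum_i uenv_map presented_map (v 0 i) *: delta_mx 0 (sub_rel s i).

Definition rel_map (r : ideal_sub (rel_ideal P)) : ideal_sub (rel_ideal Q) :=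
  IdealSub (freelie_map_rel (ideal_valP r)).

Fact rel_map_linear : linear rel_map.
Proof. by move=> a x y; apply: val_inj; rewrite /= linearP. Qed.
HB.instance Definition _ := GRing.isLinear.Build k (ideal_sub (rel_ideal P))
  (ideal_sub (rel_ideal Q)) *:%R rel_map rel_map_linear.

Fact rel_map_lie : {morph rel_map : x y / ⁅x, y⁆}.
Proof. by move=> x y; apply: val_inj; exact: lie_morph. Qed.

Fact rel_map_derived r : r \in derived _ -> rel_map r \in derived _.
Proof.
move=> /asboolP Ir; apply: (Ir [set r | rel_map r \in derived _]); split=> /=.
  split=> [|a y z Iy Iz]; first by rewrite /= linear0 rpred0.
  by rewrite /= linearP rpredD// rpredZ.
by move=> t [u _ [v _ <-]] /=; rewrite rel_map_lie lie_derived.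
Qed.

Definition relmod_map (m : relmod P) : relmod Q :=
  relmod_proj (rel_map (lie_repr m)).

Lemma relmod_mapE r : relmod_map (relmod_proj r) = relmod_proj (rel_map r).
Proof.
apply/lie_proj_eq; rewrite -linearB.
exact/rel_map_derived/lie_repr_proj.
Qed.

Fact relmod_map_is_zmod_morphism : zmod_morphism relmod_map.
Proof.
elim/relmod_projP=> r; elim/relmod_projP=> t.
have -> : relmod_proj r - relmod_proj t = relmod_proj (r - t).
  by rewrite /relmod_proj linearB.
by rewrite !relmod_mapE /relmod_proj !linearB.
Qed.
HB.instance Definition _ := GRing.isZmodMorphism.Build (relmod P) (relmod Q)
  relmod_map relmod_map_is_zmod_morphism.

Lemma relmod_mapZ u m :
  relmod_map (u *: m) = uenv_map presented_map u *: relmod_map m.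
Proof.
elim/uenv_classP: u m; elim=> [x||t IHt t' IHt'|t IHt|a t IHt||t IHt t' IHt'] m.
- elim/lie_projP: x => x; elim/relmod_projP: m => r.
  rewrite uenv_map_in/= presented_mapE relmod_scale_in !relmod_mapE relmod_scale_in.
  by congr relmod_proj; apply: val_inj; exact: lie_morph.
- by rewrite uenv_class0 rmorph0 !scale0r raddf0.
- by rewrite uenv_classD rmorphD/= !scalerDl raddfD/= IHt IHt'.
- by rewrite uenv_classN rmorphN/= !scaleNr raddfN/= IHt.
- rewrite uenv_classZ -[uenv_class t]mul1r scalerAl -scalerA rmorphM/= -scalerA.
  rewrite linearZ/= rmorph1 -IHt; elim/relmod_projP: (uenv_class t *: m) => r.
  by rewrite relmod_scale_scalar !relmod_mapE relmod_scale_scalar linearZ.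
- by rewrite uenv_class1 rmorph1 !scale1r.
- by rewrite uenv_classM rmorphM/= -!scalerA IHt IHt'.
Qed.

Lemma Pi2_map_sub v : Pi2 P v -> Pi2 Q (Pi2_map v).
Proof.
move=> v0; transitivity (relmod_map (rel_boundary v)); last by rewrite v0 raddf0.
rewrite linear_sum [in RHS]/rel_boundary raddf_sum/=; apply: eq_bigr => i _.
rewrite linearZ/= rel_boundary_delta relmod_mapZ relmod_mapE.
congr (_ *: relmod_proj _); apply: val_inj => /=.
by rewrite sub_relE.
Qed.
End Inclusion.

Section Relators.
Variables (k : comNzRingType) (L : liealgType k).
Implicit Types x y a b c : L.

Definition rel_r1 x y : L := x + ⁅x, ⁅x, y⁆⁆.
Definition rel_r2 x y : L := y - ⁅y, ⁅x, y⁆⁆.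
Definition rel_s1 x y a c : L := a + ⁅⁅x, y⁆, a⁆ + ⁅y, c⁆ - ⁅x, y⁆.
Definition rel_s2 x y b c : L := b - ⁅⁅x, y⁆, b⁆ - ⁅x, c⁆.
Definition rel_s3 x y a b c : L := c + ⁅x, a⁆ - ⁅y, b⁆.
End Relators.

Section Example.
Variable k : comNzRingType.

(* generators 0, 1 of 'I_2 are x, y *)
Definition pres_L1 : presentation k :=
  let x : freelie k 'I_2 := freelie_gen 0 in
  let y : freelie k 'I_2 := freelie_gen 1 in
  Presentation [tuple rel_r1 x y; rel_r2 x y].

(* generators 0, 1, 2, 3, 4 of 'I_5 are x, y, a, b, c *)
Definition pres_L2 : presentation k :=
  let x : freelie k 'I_5 := freelie_gen 0 in
  let y : freelie k 'I_5 := freelie_gen 1 in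
  let a : freelie k 'I_5 := freelie_gen 2 in
  let b : freelie k 'I_5 := freelie_gen 3 in
  let c : freelie k 'I_5 := freelie_gen 4 in
  Presentation [tuple rel_r1 x y; rel_r2 x y;
                      rel_s1 x y a c; rel_s2 x y b c; rel_s3 x y a b c].

Let incl : 'I_2 -> 'I_5 := widen_ord (isT : (2 <= 5)%N).

Fact incl_inj : injective incl.
Proof. by move=> i j /(congr1 val) /= /val_inj. Qed.

Fact incl_relE i : freelie_map incl (tnth (relators pres_L1) i) =
  tnth (relators pres_L2) (incl i).
Proof.
have i0 : incl 0 = 0 by apply: val_inj.
have i1 : incl 1 = 1 by apply: val_inj.
case: i => [[|[|//]] lti].
- have <- : (0 : 'I_2) = Ordinal lti by apply: val_inj.
  by rewrite i0 !(tnth_nth 0)/= linearD/= !lie_morph/= !freelie_map_gen i0 i1.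
- have <- : (1 : 'I_2) = Ordinal lti by apply: val_inj.
  by rewrite i1 !(tnth_nth 0)/= linearB/= !lie_morph/= !freelie_map_gen i0 i1.
Qed.

Definition L1_sub_L2 : subpresentation pres_L1 pres_L2 :=
  @Subpresentation k pres_L1 pres_L2 incl incl_inj incl incl_inj incl_relE.

(* the images in U(G_1) of the generators x and y *)
Definition U1_gen (i : 'I_2) : uenv (presented pres_L1) :=
  uenv_in (lie_proj (rel_ideal pres_L1) (freelie_gen i)).

Definition omega : 'rV[uenv (presented pres_L1)]_2 :=
  U1_gen 1 *: delta_mx 0 0 + U1_gen 0 *: delta_mx 0 1.
End Example.

(* Main.v *)
(* Over any commutative ring, [L_2] presents the zero Lie algebra: applying
   [ad x], [ad y], [- ad h] with [h = [x, y]] to [s_1], [s_2], [s_3] and adding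
   cancels every term in [a], [b], [c] and leaves [[x, h] = 0], that is [x = 0].
   Hence [U(G_2) = k] and [R = F], and the relators of [L_2] map to the standard
   basis of [F^ab = k^5], so that [Pi_2(L_2) = 0].  On the other hand
   [[y, r_1] + [x, r_2] = 0] holds already in the free Lie algebra, by Jacobi,
   whereas [y] is nonzero in [U(G_1)], because [G_1] acts on [k^3] through its
   adjoint representation in the basis [x, y, h]. *)
Require Import Defs.
From HB Require Import structures.
From mathcomp Require Import all_boot all_order all_algebra.
From mathcomp Require Import boolp classical_sets.

Import GRing.Theory.
Local Open Scope ring_scope.
Local Open Scope classical_set_scope.

Set Implicit Arguments.
Unset Strict Implicit.
Unset Printing Implicit Defensive.

(** * Associative algebras as Lie algebras under the commutator *)

Definition commutator_lie (k : comNzRingType) (A : algType k) : Type := A.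

Section CommutatorLie.
Variables (k : comNzRingType) (A : algType k).
HB.instance Definition _ := GRing.Algebra.on (commutator_lie A).
Local Notation L := (commutator_lie A).

Definition commutator (x y : L) : L := x * y - y * x.

Fact commutatorDl (a : k) (x y z : L) :
  commutator (a *: x + y) z = a *: commutator x z + commutator y z.
Proof.
by rewrite /commutator mulrDl mulrDr -scalerAl -scalerAr opprD addrACA scalerBr.
Qed.

Fact commutatorDr (a : k) (x y z : L) :
  commutator z (a *: x + y) = a *: commutator z x + commutator z y.
Proof.
by rewrite /commutator mulrDl mulrDr -scalerAl -scalerAr opprD addrACA scalerBr.
Qed.

Fact commutatorxx (x : L) : commutator x x = 0.
Proof. exact: subrr. Qed.

Fact commutator_jacobi (x y z : L) :
  commutator x (commutator y z) + commutator y (commutator z x)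
    + commutator z (commutator x y) = 0.
Proof.
rewrite /commutator !mulrBr !mulrBl !mulrA !opprB.
rewrite [X in _ + X + _]addrC [X in X + _]addrACA !subrKA addrACA !subrKA.
exact: subrr.
Qed.

HB.instance Definition _ := Lmodule_isLieAlgebra.Build k L
  commutatorDl commutatorDr commutatorxx commutator_jacobi.

Lemma commutatorE (x y : L) : ⁅x, y⁆ = x * y - y * x.
Proof. by []. Qed.
End CommutatorLie.

(** * A criterion for asphericity when the presented algebra is zero *)

Section Generalities.
Variable k : comNzRingType.

Lemma freelie_hom_eq0 (X : Type) (L : liealgType k) (g : lieHom (freelie k X) L) :
  (forall x, g (freelie_gen x) = 0) -> forall u, g u = 0.
Proof.
move=> g0; elim/freelie_classP; elim=> [x||s IHs t IHt|s IHs|a s IHs|s IHs t IHt].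
- exact: g0.
- by rewrite freelie_class0 linear0.
- by rewrite freelie_classD linearD/= IHs IHt addr0.
- by rewrite freelie_classN linearN/= IHs oppr0.
- by rewrite freelie_classZ linearZ/= IHs scaler0.
- by rewrite freelie_classL lie_morph IHs lie0x.
Qed.

(** The kernel of [g] is an ideal, and it contains [A]. *)
Lemma ideal_gen_hom_eq0 (L M : liealgType k) (A : set L) (g : lieHom L M) :
  (forall x, A x -> g x = 0) -> forall x, x \in ideal_gen A -> g x = 0.
Proof.
move=> g0 x /asboolP Ix; apply: (Ix [set y | g y = 0]); split=> //; split.
  split=> [|a u v /= gu gv]; first exact: linear0.
  by rewrite linearP/= gu gv scaler0 addr0.
by move=> u v /= gv; rewrite lie_morph gv liex0.
Qed.

(** When [L = 0] the generators [uenv_in x] vanish, so every term reduces to a scalar. *)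
Lemma uenv_trivial (L : liealgType k) :
  (forall x : L, x = 0) -> forall u : uenv L, exists a : k, u = a *: 1.
Proof.
move=> L0; elim/uenv_classP.
elim=> [x||s [a IHs] t [b IHt]|s [a IHs]|c s [a IHs]||s [a IHs] t [b IHt]].
- by exists 0; rewrite -[LHS]/(uenv_in x) (L0 x) linear0 scale0r.
- by exists 0; rewrite scale0r.
- by exists (a + b); rewrite uenv_classD IHs IHt scalerDl.
- by exists (- a); rewrite uenv_classN IHs scaleNr.
- by exists (c * a); rewrite uenv_classZ IHs scalerA.
- by exists 1; rewrite scale1r.
- by exists (a * b); rewrite uenv_classM IHs IHt -scalerAl mul1r scalerA.
Qed.

Lemma derived_abelian_eq0 (L M : liealgType k) (g : {linear L -> M}) :
  (forall x y, g ⁅x, y⁆ = 0) -> forall x, x \in derived L -> g x = 0.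
Proof.
move=> g0 x /asboolP Dx; apply: (Dx [set y | g y = 0]).
split=> [|_ [u _ [v _ <-]]]; last exact: g0.
split=> [|a u v /= gu gv]; first exact: linear0.
by rewrite linearP/= gu gv scaler0 addr0.
Qed.

(** The ring [k] is commutative, hence an abelian Lie algebra; it is the target of the linear forms
    on [F^ab]. *)
Lemma commutator_regular (x y : commutator_lie k^o) : ⁅x, y⁆ = 0.
Proof. by rewrite commutatorE; apply/eqP; rewrite subr_eq0; apply/eqP/mulrC. Qed.

(* [e j] encodes a linear form on [F^ab = k^(gens P)], dual to the [j]-th relator. *)
Lemma trivial_aspherical (P : presentation k)
    (e : 'I_(nrel P) -> gens P -> commutator_lie k^o) :
    (forall g : presented P, g = 0) ->
    (forall i j, freelie_lift (e j) (tnth (relators P) i) = (i == j)%:R) ->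
  Pi2 P = [set 0].
Proof.
move=> G0 eP; apply/seteqP; split=> v /=; last by move->; exact: linear0.
rewrite /Pi2/= => v0.
have [a av] := boolp.choice (fun i => uenv_trivial G0 (v 0 i)).
(* With scalar coefficients, [v] being in the kernel means that this combination of relators lies in
   [[R, R]]. *)
pose r := \sum_i a i *: IdealSub (mem_relator i).
have rD : r \in derived (ideal_sub (rel_ideal P)).
  suff : relmod_proj r = relmod_proj 0 by move/lie_proj_eq; rewrite subr0.
  rewrite {2}/relmod_proj linear0 -[RHS]v0 /relmod_proj linear_sum.
  by apply: eq_bigr => i _; rewrite av relmod_scale_scalar.
apply/rowP => j; rewrite mxE av.
suff -> : a j = 0 by rewrite scale0r.
(* The [j]-th form restricted to [R]: it kills [[R, R]] because its target is abelian, and takes the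
   value [a j] on [r]. *)
pose g : {linear ideal_sub (rel_ideal P) -> commutator_lie k^o} :=
  freelie_lift (e j) \o val.
have : g r = 0.
  apply: (derived_abelian_eq0 _ rD) => s t.
  by rewrite /g/= lie_morph commutator_regular.
rewrite linear_sum (bigD1 j)//= big1 ?addr0 => [|i /negPf ij].
  by rewrite !linearZ/= eP eqxx => <-; rewrite /GRing.scale/= mulr1.
by rewrite !linearZ/= eP ij scaler0.
Qed.
End Generalities.

(** * Representations of the presented Lie algebra detect elements of [U(G)] *)

Section Representation.
Variables (k : comNzRingType) (P : presentation k) (A : algType k).
Variable f : gens P -> commutator_lie A.
Hypothesis f_rel : forall i, freelie_lift f (tnth (relators P) i) = 0.

Definition presented_rep (g : presented P) : commutator_lie A :=
  freelie_lift f (lie_repr g).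

(** The lift kills the relators, hence the ideal they generate, so the chosen representative does
    not matter. *)
Lemma presented_repE x : presented_rep (lie_proj (rel_ideal P) x) = freelie_lift f x.
Proof.
apply/eqP; rewrite -subr_eq0 -linearB; apply/eqP.
have f0 r : r \in rel_ideal P -> freelie_lift f r = 0.
  apply: ideal_gen_hom_eq0 r => r /= /tnthP[i ->].
  exact: f_rel.
exact/f0/lie_repr_proj.
Qed.

Fact presented_rep_linear : linear presented_rep.
Proof.
move=> a; elim/lie_projP=> x; elim/lie_projP=> y.
by rewrite -linearP !presented_repE linearP.
Qed.
HB.instance Definition _ := GRing.isLinear.Build k (presented P)
  (commutator_lie A) *:%R presented_rep presented_rep_linear.

Fact presented_rep_lie x y : presented_rep ⁅x, y⁆ =
  presented_rep x * presented_rep y - presented_rep y * presented_rep x.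
Proof.
elim/lie_projP: x => x; elim/lie_projP: y => y.
by rewrite -lie_morph !presented_repE lie_morph.
Qed.

(** The representation extends to [U(G)] and sends this element to [f x]. *)
Lemma uenv_gen_neq0 x :
  f x != 0 -> uenv_in (lie_proj (rel_ideal P) (freelie_gen x)) != 0.
Proof.
apply: contraNneq => /(congr1 (uenv_lift presented_rep)).
rewrite (uenv_lift_in presented_rep_lie)/= presented_repE freelie_lift_gen => ->.
by apply/eqP; rewrite -uenv_class0 (uenv_liftE presented_rep_lie).
Qed.
End Representation.

(** * The relations of [L_2] force all five generators to vanish *)

Section Perfect.
Variables (k : comNzRingType) (L : liealgType k).

Lemma relations_L2_trivial (x y a b c : L) :
    rel_r1 x y = 0 -> rel_r2 x y = 0 -> rel_s1 x y a c = 0 ->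
    rel_s2 x y b c = 0 -> rel_s3 x y a b c = 0 ->
  [/\ x = 0, y = 0, a = 0, b = 0 & c = 0].
Proof.
rewrite /rel_r1 /rel_r2 /rel_s1 /rel_s2 /rel_s3; set h := ⁅x, y⁆.
move=> r1 r2 s1 s2 s3.
(* The first two relations make [x] and [y] eigenvectors of [ad h], with eigenvalues 1 and -1. *)
have hx : ⁅h, x⁆ = x by rewrite lieC; apply/esym/eqP; rewrite -addr_eq0 r1.
have hy : ⁅h, y⁆ = - y.
  by rewrite lieC; congr (- _); apply/esym/eqP; rewrite -subr_eq0 r2.
(* Since [ad h] is a derivation, [x] and [y] move past it at the cost of [[x, a]] and [[y, b]];
   these will cancel the images of the leading terms of [s1] and [s2]. *)
have xha : ⁅x, ⁅h, a⁆⁆ = ⁅h, ⁅x, a⁆⁆ - ⁅x, a⁆.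
  by rewrite -[in X in _ - X]hx lie_ad opprB addrC subrK.
have yhb : ⁅y, ⁅h, b⁆⁆ = ⁅h, ⁅y, b⁆⁆ + ⁅y, b⁆.
  by rewrite -[X in _ + X]opprK -lieNx -hy lie_ad opprB addrC subrK.
have xyc : ⁅x, ⁅y, c⁆⁆ = ⁅h, c⁆ + ⁅y, ⁅x, c⁆⁆ by rewrite lie_ad subrK.
have yxc : ⁅y, ⁅x, c⁆⁆ = - ⁅h, ⁅y, b⁆⁆.
  have := congr1 (lie y) s2; rewrite !(liexD, liexN) liex0 yhb.
  rewrite [_ + ⁅y, b⁆]addrC opprD addrA subrr add0r => /eqP.
  by rewrite subr_eq0 => /eqP <-.
(* Applying [ad x] to [s1] now expresses [[x, h]] as [ad h] of the left side of [s3]. *)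
have xh : ⁅x, h⁆ = 0.
  have := congr1 (lie x) s1; rewrite !(liexD, liexN) liex0 xha xyc yxc.
  rewrite [⁅x, a⁆ + _]addrC subrK => /eqP; rewrite subr_eq0 => /eqP <-.
  have := congr1 (lie h) s3; rewrite !(liexD, liexN) liex0 => <-.
  by rewrite addrA [⁅h, c⁆ + _]addrC.
have x0 : x = 0 by rewrite -hx lieC xh oppr0.
have h0 : h = 0 by rewrite /h x0 lie0x.
have y0 : y = 0 by apply: oppr_inj; rewrite -hy h0 lie0x oppr0.
split=> //.
- by move: s1; rewrite h0 y0 !lie0x subr0 !addr0.
- by move: s2; rewrite h0 x0 !lie0x !subr0.
- by move: s3; rewrite x0 y0 !lie0x addr0 subr0.
Qed.
End Perfect.

(** * Vanishing of [G_2] and of [Pi_2(L_2)] *)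

Section Counterexample.
Variable k : comNzRingType.

(** Case analysis that returns the indices as the numerals used in [pres_L2]. *)
Lemma ord5P (Q : 'I_5 -> Prop) : Q 0 -> Q 1 -> Q 2 -> Q 3 -> Q 4 -> forall i, Q i.
Proof.
move=> Q0 Q1 Q2 Q3 Q4 [[|[|[|[|[|//]]]]] lti].
- by have -> : Ordinal lti = 0 by apply: val_inj.
- by have -> : Ordinal lti = 1 by apply: val_inj.
- by have -> : Ordinal lti = 2 by apply: val_inj.
- by have -> : Ordinal lti = 3 by apply: val_inj.
- by have -> : Ordinal lti = 4 by apply: val_inj.
Qed.

Lemma presented_L2_trivial (g : presented (pres_L2 k)) : g = 0.
Proof.
pose p (i : 'I_5) : presented (pres_L2 k) :=
  lie_proj (rel_ideal (pres_L2 k)) (freelie_gen i).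
have rel0 i : lie_proj (rel_ideal (pres_L2 k)) (tnth (relators (pres_L2 k)) i) = 0.
  rewrite -(linear0 (lie_proj (rel_ideal (pres_L2 k)))).
  by apply/lie_proj_eq; rewrite subr0 mem_relator.
have [] := @relations_L2_trivial k _ (p 0) (p 1) (p 2) (p 3) (p 4).
- by rewrite -(rel0 0) (tnth_nth 0)/= linearD/= !lie_morph.
- by rewrite -(rel0 1) (tnth_nth 0)/= linearB/= !lie_morph.
- by rewrite -(rel0 2) (tnth_nth 0)/= linearB !linearD/= !lie_morph.
- by rewrite -(rel0 3) (tnth_nth 0)/= !linearB/= !lie_morph.
- by rewrite -(rel0 4) (tnth_nth 0)/= linearB linearD/= !lie_morph.
move=> p0 p1 p2 p3 p4; elim/lie_projP: g.
by apply: freelie_hom_eq0; elim/ord5P.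
Qed.

Lemma Pi2_L2 : Pi2 (pres_L2 k) = [set 0].
Proof.
(* Coordinate forms: brackets vanish in [k], and the linear part of the [i]-th relator is the [i]-th
   generator. *)
apply: (@trivial_aspherical k (pres_L2 k) (fun j i => (i == j)%:R)).
  exact: presented_L2_trivial.
move=> i j; elim/ord5P: i; rewrite (tnth_nth 0)/=
  /rel_r1 /rel_r2 /rel_s1 /rel_s2 /rel_s3 !(linearD, linearN)/= !lie_morph
  !commutator_regular ?oppr0 ?addr0 freelie_lift_gen; reflexivity.
Qed.

(** * The identity [omega] over [L_1] *)

Lemma omega_Pi2 : Pi2 (pres_L1 k) (omega k).
Proof.
(* Appending [+ 0] gives both summands the shape [a *: u + v] that [rel_boundary_linear] expects. *)
rewrite /Pi2/= /omega -[U1_gen k 0 *: _]addr0 !rel_boundary_linear.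
rewrite (linear0 (@rel_boundary k (pres_L1 k))) addr0 !rel_boundary_delta.
rewrite /U1_gen !relmod_scale_in /relmod_proj -linearD -[RHS](linear0 (lie_proj _)).
congr (lie_proj _ _); apply: val_inj.
rewrite raddfD/= !(tnth_nth 0)/= /rel_r1 /rel_r2.
set x := freelie_gen 0; set y := freelie_gen 1.
(* The terms [[y, x]] and [[x, y]] cancel; with [h = [x, y]], what remains is [[y, [x, h]] - [x,
   [y, h]] = [[y, x], h] = - [h, h]]. *)
rewrite !(liexD, liexN) addrACA [X in X + _ = _]addrC [⁅y, x⁆]lieC subrr add0r.
by rewrite -lie_ad [⁅y, x⁆]lieC lieNx liexx oppr0.
Qed.

(* The matrices of [ad x] and [ad y] in the basis [x, y, h]. *)
Definition ad_x : commutator_lie 'M[k]_3 := delta_mx 2 1 - delta_mx 0 2.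
Definition ad_y : commutator_lie 'M[k]_3 := delta_mx 1 2 - delta_mx 2 0.

Let mul_delta (i j l m : 'I_3) :
  (delta_mx i j : commutator_lie 'M[k]_3) * delta_mx l m = delta_mx i m *+ (j == l).
Proof. exact: mul_delta_mx_cond. Qed.

(** This matrix is [ad h], diagonal with entries 1, -1, 0 on [x], [y], [h]. *)
Lemma lie_ad_xy : ⁅ad_x, ad_y⁆ = delta_mx 0 0 - delta_mx 1 1.
Proof.
rewrite commutatorE /ad_x /ad_y !(mulrBl, mulrBr) !mul_delta/= !mulr0n !mulr1n.
rewrite !(subr0, sub0r, opprK). by rewrite [delta_mx 2 2 + _]addrC [delta_mx 1 1 + _]addrC addrKA.
Qed.

Lemma ad_rel_r1 : rel_r1 ad_x ad_y = 0.
Proof.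
rewrite /rel_r1 lie_ad_xy commutatorE /ad_x !(mulrBl, mulrBr) !mul_delta/=.
rewrite !mulr0n !mulr1n !(subr0, sub0r, opprK, oppr0, add0r, addr0).
by rewrite addrACA subrr addNr addr0.
Qed.

Lemma ad_rel_r2 : rel_r2 ad_x ad_y = 0.
Proof.
rewrite /rel_r2 lie_ad_xy commutatorE /ad_y !(mulrBl, mulrBr) !mul_delta/=.
rewrite !mulr0n !mulr1n !(subr0, sub0r, opprK, oppr0, add0r, addr0).
by rewrite [- _ + _]addrC subrr.
Qed.

Lemma ad_y_neq0 : ad_y != 0.
Proof.
(* This entry records [[y, h] = y]; it is 1, hence nonzero in every characteristic. *)
apply/eqP => /matrixP/(_ 1 2)/eqP.
by rewrite !mxE/= subr0 oner_eq0.
Qed.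

Lemma omega_neq0 : omega k <> 0.
Proof.
(* Coordinate [0] of [omega] is the image of [y] in [U(G_1)], which acts as [ad_y]. *)
move=> /rowP/(_ 0); rewrite !mxE/= mulr1 mulr0 addr0; apply/eqP.
pose f (i : 'I_2) := if i == 0 then ad_x else ad_y.
apply: (@uenv_gen_neq0 k (pres_L1 k) _ f); last exact: ad_y_neq0.
case=> [[|[|//]] lti]; rewrite (tnth_nth 0)/= !(linearD, linearN)/=.
- by rewrite !lie_morph/= !freelie_lift_gen; exact: ad_rel_r1.
- by rewrite !lie_morph/= !freelie_lift_gen; exact: ad_rel_r2.
Qed.

(** The coefficients of [omega] are images of generators, and these die in [U(G_2)] because
    [G_2 = 0]. *)
Lemma omega_map0 : Pi2_map (L1_sub_L2 k) (omega k) = 0.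
Proof.
have in0 (x : presented (pres_L2 k)) : uenv_in x = 0.
  by rewrite (presented_L2_trivial x) linear0.
rewrite /Pi2_map big1 // => i _; rewrite !mxE rmorphD !rmorphM/= /U1_gen.
by rewrite !uenv_map_in !in0 !mul0r addr0 scale0r.
Qed.

Lemma L1_non_aspherical : Pi2 (pres_L1 k) <> [set 0].
Proof. by move=> L1; have := omega_Pi2; rewrite L1 => /omega_neq0. Qed.
End Counterexample.

Theorem theorem2p1 :
  [/\ Pi2 (pres_L1 int) <> [set 0],
      Pi2 (pres_L2 int) = [set 0],
      forall k : fieldType,
        [/\ inhabited (subpresentation (pres_L1 k) (pres_L2 k)),
            ~ aspherical (pres_L1 k) &
            aspherical (pres_L2 k)],
      forall k : fieldType,
        ~ (forall P Q : presentation k,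
             subpresentation P Q -> aspherical Q -> aspherical P) &
      [/\ Pi2 (pres_L1 int) (omega int),
          omega int <> 0 &
          Pi2_map (L1_sub_L2 int) (omega int) = 0] ].
Proof.
split.
- exact: L1_non_aspherical.
- exact: Pi2_L2.
- move=> k; split; [exact/inhabits/L1_sub_L2|exact: L1_non_aspherical|exact: Pi2_L2].
- move=> k asph; apply: (@L1_non_aspherical k).
  exact: asph (L1_sub_L2 k) (Pi2_L2 k).
- split; [exact: omega_Pi2|exact: omega_neq0|exact: omega_map0].
Qed.
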